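(* The number $R_3(L)$ satisfies $R_3(L) \leq 772$.
   Context: For a positive integer $n$, the $n \times n$ integer grid is $[n]\times[n]=\{(i,j): 1\le i,j\le n\}$, where $(i,j)$ is the point in row $i$ (rows counted downward) and column $j$ (columns counted left to right). Given a coloring of $[n]\times[n]$ with $k$ colors (an arbitrary map from $[n]\times[n]$ to a set of $k$ colors), a monochromatic $L$ is a set of three points $\{(x,y),(x+d,y),(x+d,y+d)\}\subseteq [n]\times[n]$, with $d$ a positive integer, all having the same color. For a positive integer $k$, $R_k(L)$ denotes the least positive integer $n$ such that every $k$-coloring of $[n]\times[n]$ contains a monochromatic $L$ (it exists by the Gallai-Witt theorem). *)

(* Defs.v *)
From mathcomp Require Import all_boot.

Set Implicit Arguments.
Unset Strict Implicit.
Unset Printing Implicit Defensive.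

(* The point (i, j) of [n] x [n], 1 <= i, j <= n, is encoded by the pair
   (i - 1, j - 1); the first component is the row. *)
Definition grid (n : nat) : finType := ('I_n * 'I_n)%type.

Definition is_L (n : nat) (A : {set grid n}) : Prop :=
  exists (x y x' y' : 'I_n) (d : nat),
    [/\ 0 < d, x' = x + d :> nat, y' = y + d :> nat
      & A = [set (x, y); (x', y); (x', y')]].

Definition monochromatic (n k : nat) (c : grid n -> 'I_k) (A : {set grid n}) :
    Prop :=
  forall p q : grid n, p \in A -> q \in A -> c p = c q.

Definition every_coloring_has_mono_L (k n : nat) : Prop :=
  forall c : grid n -> 'I_k,
    exists A : {set grid n}, is_L A /\ monochromatic c A.

(* R_k(L) = r.  The number is given by its graph, so that a statement about it
   asserts its existence instead of relying on a default value. *)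
Definition is_RL (k r : nat) : Prop :=
  [/\ 0 < r, every_coloring_has_mono_L k r
    & forall n : nat, 0 < n -> every_coloring_has_mono_L k n -> r <= n].

(* Main.v *)
(* Suppose a 3-coloring has no monochromatic L.  Some color r occurs on a set S
   of at least 258 of the 772 diagonal points (a, a); then (b, a) is not r for
   a < b in S.  By van der Corput's inequality some d > 0 is a difference of at
   least 78 pairs of S, so at least 39 of the points (a + d, a) with a, a + d
   in S share a second color; let T be the set of these a.  For a < b in T the
   point (b + d, a) is the corner over both pairs and has the third color.
   Being too dense to be a Sidon set, T contains x < y, x + e and y + e for some
   e > 0, and then (x + e + d, x), (y + e + d, x), (y + e + d, y) all have the
   third color. *)
Require Import Defs.
From mathcomp Require Import all_boot.
From Stdlib Require Import Classical_Prop Wf_nat.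
From mathcomp Require Import zify.

Lemma sum_eq_ord (M g : nat) : g < M -> \sum_(m < M) (g == m :> nat) = 1.
Proof.
move=> gM; rewrite (bigD1 (Ordinal gM)) //= eqxx big1 // => m.
by rewrite -val_eqE /= eq_sym => /negPf->.
Qed.

(** If [f m] is the size of the fiber of [g] over [m], the double sum is the sum of the [f m ^ 2];
    add up [2 * c * f m <= c ^ 2 + f m ^ 2] over the [M] possible values. *)
Lemma sum_collisions (T : finType) (D : {set T}) (g : T -> nat) (M c : nat) :
  (forall p, p \in D -> g p < M) ->
  2 * c * #|D| <=
    M * c ^ 2 + \sum_(p in D) \sum_(q in D) (g p == g q).
Proof.
move=> gM; pose f m := \sum_(p in D) (g p == m).
have -> : #|D| = \sum_(m < M) f m.
  rewrite exchange_big -sum1_card; apply: eq_bigr => p pD.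
  by rewrite sum_eq_ord ?gM.
have -> : \sum_(p in D) \sum_(q in D) (g p == g q) = \sum_(m < M) f m ^ 2.
  transitivity (\sum_(m < M) \sum_(p in D) \sum_(q in D)
                  (g p == m) * (g q == m)).
    rewrite [RHS]exchange_big; apply: eq_bigr => p pD.
    rewrite [RHS]exchange_big; apply: eq_bigr => q qD /=.
    rewrite (bigD1 (Ordinal (gM p pD))) //= eqxx mul1n eq_sym big1 ?addn0 //.
    by move=> m; rewrite -val_eqE /= eq_sym => /negPf->.
  apply: eq_bigr => m _; rewrite -mulnn big_distrl /=.
  by apply: eq_bigr => p _; rewrite big_distrr.
have -> : M * c ^ 2 = \sum_(m < M) c ^ 2 by rewrite sum_nat_const card_ord.
rewrite -big_split big_distrr /=.
by apply: leq_sum => m _; rewrite -mulnA nat_Cauchy.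
Qed.

Definition common_points (N : nat) (P : pred nat) (d : nat) : {set 'I_N} :=
  [set x : 'I_N | P x && P (x + d)].

(* Van der Corput's argument: compare the translates P + i for i < W inside
   [0, N + W).  The parameter c stands for the mean number of translates through
   a point, so that x ^ 2 >= 2 c x - c ^ 2 plays the role of Cauchy-Schwarz. *)
Lemma popular_difference (N W c A : nat) (P : pred nat) :
  (forall x, P x -> x < N) ->
  (N + W) * c ^ 2 + W * #|[set x : 'I_N | P x]| + W * W.-1 * A
    < 2 * c * (#|[set x : 'I_N | P x]| * W) ->
  exists d, 0 < d < W /\ A < #|common_points N P d|.
Proof.
move=> PN; set S := [set x : 'I_N | P x] => big.
have [/existsP[d /andP[d0 Ad]]|noA] :=
    boolP [exists d : 'I_W, (0 < d) && (A < #|common_points N P d|)].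
  by exists d; rewrite d0 ltn_ord.
have leA (d : nat) : 0 < d < W -> #|common_points N P d| <= A.
  case/andP=> d0 dW; rewrite leqNgt; apply: contra noA => Ad.
  by apply/existsP; exists (Ordinal dW); rewrite d0.
pose D := setX S [set: 'I_W]; pose g (p : 'I_N * 'I_W) := p.1 + p.2.
have le_col : 2 * c * (#|S| * W) <=
    (N + W) * c ^ 2 + \sum_(p in D) \sum_(q in D) (g p == g q).
  have -> : #|S| * W = #|D| by rewrite cardsX cardsT card_ord.
  apply: sum_collisions.
  by move=> [x i] _; rewrite /g /= -addSn leq_add // ltnW.
have coll (i j : 'I_W) : \sum_(x in S) \sum_(y in S) (x + i == y + j)
    <= if i == j then #|S| else A.
  (* A collision means [x = y + (l - k)]: then [y] is a common point for the difference [l - k], and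
     it determines [x]. *)
  have lt_coll (k l : 'I_W) : k < l ->
      \sum_(y in S) \sum_(x in S) (x + k == y + l) <= A.
    move=> kl; apply: leq_trans (leA (l - k) _); last first.
      by have := ltn_ord l; lia.
    rewrite -sum1_card big_mkcond [leqRHS]big_mkcond /=; apply: leq_sum => y _.
    rewrite !inE; case: ifP => //= Py.
    case: ifP => Pyd.
      rewrite (bigD1 (Ordinal (PN _ Pyd))) ?inE //= big1 => [|x].
        by rewrite addn0 leq_b1.
      by rewrite -val_eqE /=; lia.
    rewrite big1 // => x; rewrite inE => Px; apply/eqP; rewrite eqb0.
    apply: contraFN Pyd => /eqP e; suff -> : y + (l - k) = x by [].
    by lia.
  case: (ltngtP i j) => [ij|ji|/val_inj->].
  - by rewrite -val_eqE ltn_eqF //= exchange_big lt_coll.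
  - rewrite -val_eqE gtn_eqF //=.
    by under eq_bigr do under eq_bigr do rewrite eq_sym; apply: lt_coll.
  rewrite eqxx -sum1_card; apply: leq_sum => x xS.
  rewrite (bigD1 x) //= eqxx big1 // => y /andP[_].
  by rewrite -val_eqE /=; lia.
(* The [W] pairs of equal shifts contribute [#|S|] each, the [W * W.-1] other ordered pairs at most
   [A] each. *)
have: \sum_(p in D) \sum_(q in D) (g p == g q)
    <= W * #|S| + W * W.-1 * A.
  have -> : \sum_(p in D) \sum_(q in D) (g p == g q) =
      \sum_(i < W) \sum_(j < W) \sum_(x in S) \sum_(y in S) (x + i == y + j).
    have split_D (F : 'I_N * 'I_W -> nat) :
        \sum_(p in D) F p = \sum_(i < W) \sum_(x in S) F (x, i).
      rewrite exchange_big pair_big /=; apply: eq_big => [[x i]|[x i] _] //=.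
      by rewrite !inE andbT.
    rewrite split_D; apply: eq_bigr => i _.
    rewrite [RHS]exchange_big; apply: eq_bigr => x _.
    by rewrite split_D.
  have -> : W * #|S| + W * W.-1 * A = \sum_(i < W) (#|S| + W.-1 * A).
    by rewrite sum_nat_const card_ord mulnDr mulnA.
  apply: leq_sum => i _.
  apply: (@leq_trans (\sum_(j < W) if i == j then #|S| else A)).
    by apply: leq_sum => j _; apply: coll.
  rewrite (bigD1 i) //= eqxx leq_add2l.
  rewrite (eq_bigr (fun=> A)) => [|j]; last by rewrite eq_sym => /negPf->.
  by rewrite sum_nat_const cardC1 card_ord.
by lia.
Qed.

(** Pigeonhole with the values confined to [D], so that a color already excluded is not counted. *)
Lemma popular_value (T C : finType) (X : {set T}) (D : pred C) (f : T -> C)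
    (K : nat) :
  (forall x, x \in X -> f x \in D) -> K * #|D| < #|X| ->
  exists2 r, r \in D & K < #|[set x in X | f x == r]|.
Proof.
move=> fD big; apply/exists_inP; apply: contraLR big.
rewrite negb_exists_in -leqNgt => /forall_inP small.
have -> : #|X| = \sum_(r in D) #|[set x in X | f x == r]|.
  rewrite -sum1_card (partition_big f D) //; apply: eq_bigr => r _.
  by rewrite -sum1_card; apply: eq_bigl => x; rewrite !inE.
rewrite mulnC -sum_nat_const; apply: leq_sum => r rD.
by rewrite leqNgt small.
Qed.

Lemma third_color (r b u v : 'I_3) :
  r != b -> u != r -> u != b -> v != r -> v != b -> u = v.
Proof.
rewrite -!val_eqE /= => *; apply: val_inj => /=.
move: (ltn_ord r) (ltn_ord b) (ltn_ord u) (ltn_ord v); lia.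
Qed.

(* 772 is kept behind an equation so that it is never unfolded to unary form. *)
Lemma L_in_772 (c : nat -> nat -> 'I_3) (N : nat) : N = 772 ->
  exists x y d, [/\ 0 < d, x + d < N, y + d < N,
    c x y = c (x + d) y & c (x + d) (y + d) = c (x + d) y].
Proof.
move=> N772; apply: NNPP => noL.
(* Two points of one color on a line parallel to the diagonal are the ends of an L, whose corner
   [(x', y)] must differ in color. *)
have noLP x y x' y' : x < x' < N -> y' < N -> x' + y = x + y' ->
    c x y = c x' y' -> c x' y != c x y.
  move=> /andP[xx' x'N] y'N e cc; apply/eqP => cx; apply: noL.
  have y'E : y' = y + (x' - x) by lia.
  have x'E : x' = x + (x' - x) by lia.
  by exists x, y, (x' - x); rewrite -x'E -y'E; split=> //; try lia; congruence.
have [] := @popular_value _ _ [set: 'I_N] predT (fun x => c x x) 257.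
- by [].
- by rewrite cardsT !card_ord; lia.
move=> r _ Sbig; pose S x := (x < N) && (c x x == r).
have SN x : S x -> x < N by case/andP.
have nr a b : S a -> S b -> a < b -> c b a != r.
  move=> /andP[aN /eqP ca] /andP[bN /eqP cb] ab.
  by rewrite -ca; apply: (noLP _ _ b b); rewrite ?ab // ?ca ?cb // addnC.
have {}Sbig : 257 < #|[set x : 'I_N | S x]|.
  apply: leq_trans Sbig _; apply/subset_leq_card/subsetP => x.
  by rewrite !inE /S ltn_ord.
(* [14] is close to the mean [258 * 45 / 817]; the condition becomes [312592 < 1215 * s], true from
   [s = 258] on. *)
have [|d [/andP[d0 _] dbig]] := @popular_difference N 45 14 77 S SN.
  by move: (#|_|) Sbig => s; lia.
have [] := @popular_value _ _ (common_points N S d) (predC1 r)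
             (fun x => c (x + d) x) 38.
- by move=> x; rewrite !inE => /andP[Sx Sxd]; apply: nr => //; lia.
- by rewrite cardC1 card_ord; lia.
move=> b; rewrite inE /= => br Tbig.
pose T x := [&& S x, S (x + d) & c (x + d) x == b].
have TN x : T x -> x < N by case/and3P => /SN.
have {}Tbig : 38 < #|[set x : 'I_N | T x]|.
  apply: leq_trans Tbig _; apply/subset_leq_card/subsetP => x.
  by rewrite !inE -andbA.
have nrb x y : T x -> T y -> x < y -> c (y + d) x != r /\ c (y + d) x != b.
  move=> /and3P[Sx Sxd /eqP cx] /and3P[Sy Syd /eqP cy] xy; split.
    by apply: nr => //; lia.
  rewrite -cx; apply: (noLP _ _ (y + d) y); rewrite ?cx ?cy //.
  - by rewrite ltn_add2r xy SN.
  - exact: SN.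
  - by lia.
(* With [A = 1] some difference occurs twice; the condition is [23852 < 700 * t], and [t] is at
   least [39]. *)
have [|e [/andP[e0 _] ebig]] := @popular_difference N 100 4 1 T TN.
  by move: (#|_|) Tbig => t; lia.
have [x [y [Tx Ty xy]]] : exists x y, [/\ T x && T (x + e),
    T y && T (y + e) & x < y].
  case/card_gt1P: ebig => x [y []]; rewrite !inE => Tx Ty.
  rewrite -val_eqE /= neq_ltn => /orP[xy|yx].
  - by exists x, y.
  - by exists y, x.
case/andP: Tx Ty => Tx Txe /andP[Ty Tye].
have [|r1 b1] := nrb x (x + e) Tx Txe; first by clear -e0; lia.
have [|r2 b2] := nrb y (y + e) Ty Tye; first by clear -e0; lia.
have [r3 b3] := nrb x (y + e) Tx Tye (ltn_addr e xy).
have rb : r != b by rewrite eq_sym.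
have eN : y + e + d < N by case/and3P: Tye => _ /SN.
have yN := TN _ Ty.
have /negP[] : c (y + e + d) x != c (x + e + d) x.
  apply: (noLP _ _ _ y) => //; last exact: (third_color r b).
    by rewrite !ltn_add2r xy eN.
  by clear; lia.
exact/eqP/(third_color r b).
Qed.

Theorem theorem5 : exists r : nat, is_RL 3 r /\ r <= 772.
Proof.
pose Q n := 0 < n /\ every_coloring_has_mono_L 3 n.
have [M M772] : exists M, M = 772 by exists 772.
have QM : Q M.
  split=> [|c]; first by lia.
  (* [inord] needs a successor bound. The L obtained lies inside the grid, so the default value of
     [inord] does not affect it. *)
  have [M' M'E] : exists M', M = M'.+1 by exists M.-1; lia.
  rewrite {}M'E in M772 c *.
  have [x [y [d [d0 xd yd e1 e2]]]] :=
    @L_in_772 (fun x y => c (inord x, inord y)) _ M772.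
  exists [set (inord x, inord y); (inord (x + d), inord y);
              (inord (x + d), inord (y + d))]; split.
    exists (inord x), (inord y), (inord (x + d)), (inord (y + d)), d.
    by split=> //; rewrite !inordK //; lia.
  have col p : p \in [set (inord x, inord y); (inord (x + d), inord y);
              (inord (x + d), inord (y + d))] ->
      c p = c (inord (x + d), inord y).
    by rewrite !inE => /orP[/orP[]|] /eqP->.
  by move=> p q /col-> /col->.
have [r [[[r0 Qr] r_min] _]] :=
  dec_inh_nat_subset_has_unique_least_element Q (fun n => classic (Q n))
    (ex_intro _ M QM).
exists r; rewrite -M772; split; last exact/leP/r_min.
by split=> // n n0 Qn; apply/leP/r_min.
Qed.
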